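(* There is a social choice function (for facility location on $[0,1]$ with single-peaked preferences and tree-shaped invitation networks) that satisfies strategy-proofness over networks (SP), Pareto efficiency (PE), anonymity on distances (AN-D), and $1$-distance voter-relevance (VR-$1$).
   Context: Outcomes and preferences. The outcome set is $\mathcal{O}=[0,1]$. A preference is a complete and transitive binary relation $\succsim$ on $\mathcal{O}$ (strict part $\succ$). It is single-peaked if there is a point $p\in\mathcal{O}$ (its peak) such that for all distinct $x,y\in\mathcal{O}$: if $p\le x<y$ or $y<x\le p$ then $x\succ y$. Let $\mathcal{R}$ be the set of single-peaked preferences. The peak of voter $i$'s preference $\succ_i$ is denoted $p_i$. Networks and types. $\mathcal{N}$ is the set of potential voters and $m\notin\mathcal{N}$ is the moderator. The set $r_m\subseteq\mathcal{N}$ consists of the children of $m$, and for each voter $i$ the set $r_i\subseteq\mathcal{N}\setminus\{i\}$ consists of the children of $i$. Together, $r_m$ and $(r_i)_{i\in\mathcal{N}}$ specify the social network $G$ (a directed edge from each parent to each of its children), which is assumed to be a directed tree with single source $m$. The true type of voter $i$ is $\theta_i=(\succ_i,r_i)$ with $\succ_i\in\mathcal{R}$; $\theta=(\theta_i)_i$ is a type profile and $\theta_{-i}$ is the profile of the types of the voters other than $i$. The set $r_m$ is not part of any type and is not reported by any voter. Reports. A voter with true type $\theta_i=(\succ_i,r_i)$ can report (as her action) any element of $R(\theta_i)=\{(\succ_i',r_i') : \succ_i'\in\mathcal{R},\ r_i'\subseteq r_i\}$. Write $\theta'_{-i}\in R(\theta_{-i})$ if $\theta_j'\in R(\theta_j)$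 for all $j\ne i$, and $\theta'\in R(\theta)$ if $\theta'_j\in R(\theta_j)$ for all $j$. Given a reported profile $\theta'$, the participating voters $\hat N(\theta')$ are those to whom there is a directed path from $m$ in the network formed by $r_m$ and the reported sets $r_i'$. Social choice function (SCF). An SCF $f$ is deterministic and maps each reported profile $\theta'\in R(\theta)$ to an outcome in $\mathcal{O}$, where $f$ can use only the reported preferences and reported children of the participating voters $\hat N(\theta')$. It is defined for every set of participating voters. SP. $f$ is strategy-proof over networks if for any set $N\subseteq\mathcal{N}$ of voters, any $i\in N$, any $\theta_{-i}$, any $\theta'_{-i}\in R(\theta_{-i})$, any $\theta_i=(\succ_i,r_i)$ and any $\theta'_i\in R(\theta_i)$: $f(\theta_i,\theta'_{-i})\succsim_i f(\theta'_i,\theta'_{-i})$. PE. $f$ is Pareto efficient if for every profile $\theta$ there is no outcome $o\in\mathcal{O}$ with $o\succsim_i f(\theta)$ for all participating voters $i$ and $o\succ_i f(\theta)$ for some participating voter $i$. AN-D. Given a social network, let $N_D(d)$ be the set of participating voters at distance $d$ from $m$ (number of edges of the directed path). $f$ satisfies AN-D if for any $\theta$, any integer $d\ge 0$, and any $\theta'$ obtained from $\theta$ by having any subset of the voters in $N_D(d)$ permute their preferences, $f(\theta)=f(\theta')$. VR-$d$. For an integer $d\ge 0$, $f$ is $d$-distance voter-relevant if, for any voter $i\in\bigcup_{1\le d'\le d}N_D(d')$ (the sets $N_D(d')$ being those of the given social network) and any $\theta_i$, there exists a profile $\theta'_{-i}$ of the other voters' actions such that $f(\theta'_i,\theta'_{-i})\ne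 f(\theta''_i,\theta'_{-i})$ for some $\theta'_i,\theta''_i\in R(\theta_i)$. *)

(* Defs.v *)
From mathcomp Require Import all_boot all_order all_fingroup all_algebra.
From mathcomp Require Import reals.

Set Implicit Arguments.
Unset Strict Implicit.
Unset Printing Implicit Defensive.

Import Order.TTheory GRing.Theory Num.Theory.
Local Open Scope ring_scope.

Definition outcome (R : realType) := {x : R | 0 <= x <= 1}.

Definition strict (T : Type) (P : T -> T -> Prop) (x y : T) : Prop :=
  P x y /\ ~ P y x.

Definition is_peak (R : realType) (P : outcome R -> outcome R -> Prop)
    (p : outcome R) : Prop :=
  forall x y : outcome R,
    (sval p <= sval x /\ sval x < sval y) \/
    (sval y < sval x /\ sval x <= sval p) ->
    strict P x y.

Record preference (R : realType) := Preference {
  weak :> outcome R -> outcome R -> Prop;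
  weak_complete : forall x y, weak x y \/ weak y x;
  weak_transitive : forall x y z, weak x y -> weak y z -> weak x z;
  weak_single_peaked : exists p, is_peak weak p }.

(* A type, and likewise a report: a preference and a set of children. *)
Definition vtype (R : realType) (V : finType) := (preference R * {set V})%type.

Definition profile (R : realType) (V : finType) := V -> vtype R V.

Definition upd (R : realType) (V : finType) (theta : profile R V) (i : V)
    (t : vtype R V) : profile R V :=
  fun j => if j == i then t else theta j.

(* The vertices of a network are [None], the moderator, and [Some i] for each
   voter [i]; [rm] is the set of children of the moderator. *)
Definition children (R : realType) (V : finType) (rm : {set V})
    (theta : profile R V) (x : option V) : {set V} :=
  if x is Some i then (theta i).2 else rm.

Definition edge (R : realType) (V : finType) (rm : {set V})
    (theta : profile R V) : rel (option V) :=
  fun x y => if y is Some j then j \in children rm theta x else false.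

(* A directed tree on the moderator and the voters of [N], rooted at the
   moderator: each vertex is reached from the root by exactly one directed walk.
   [path] does not exclude repeated vertices, so uniqueness rules out cycles.
   The values of [theta] outside [N] are irrelevant. *)
Definition network (R : realType) (V : finType) (N rm : {set V})
    (theta : profile R V) : Prop :=
  [/\ rm \subset N,
      forall i, i \in N -> (theta i).2 \subset N :\ i
    & forall i, i \in N ->
        exists! p : seq (option V),
          path (edge rm theta) None p /\ last None p = Some i].

Definition reportable (R : realType) (V : finType) (t t' : vtype R V) : Prop :=
  t'.2 \subset t.2.

Definition participants (R : realType) (V : finType) (rm : {set V})
    (theta : profile R V) : {set V} :=
  [set i | connect (edge rm theta) None (Some i)].

Definition at_distance (R : realType) (V : finType) (rm : {set V})
    (theta : profile R V) (d : nat) : {set V} :=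
  [set i in participants rm theta |
    [exists p : d.-tuple (option V),
      path (edge rm theta) None p && (last None p == Some i)]].

(* The input of a social choice function is a partial profile, undefined exactly
   at the voters who do not participate; hence it can depend on nothing but the
   reports of the participating voters. *)
Definition scf (R : realType) (V : finType) :=
  (V -> option (vtype R V)) -> outcome R.

Definition observed (R : realType) (V : finType) (rm : {set V})
    (theta : profile R V) : V -> option (vtype R V) :=
  fun i => if i \in participants rm theta then Some (theta i) else None.

(* [theta' i] plays no role: it is overwritten in both profiles. *)
Definition strategy_proof (R : realType) (V : finType) (f : scf R V) : Prop :=
  forall (N rm : {set V}) (theta : profile R V), network N rm theta ->
  forall i, i \in N ->
  forall theta' : profile R V,
    (forall j, j \in N -> j != i -> reportable (theta j) (theta' j)) ->
  forall ti' : vtype R V, reportable (theta i) ti' ->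
    (theta i).1 (f (observed rm (upd theta' i (theta i))))
                (f (observed rm (upd theta' i ti'))).

Definition pareto_efficient (R : realType) (V : finType) (f : scf R V) : Prop :=
  forall (N rm : {set V}) (theta : profile R V), network N rm theta ->
  ~ exists o : outcome R,
      (forall i, i \in participants rm theta ->
         (theta i).1 o (f (observed rm theta))) /\
      (exists2 i, i \in participants rm theta &
         strict (theta i).1 o (f (observed rm theta))).

Definition permute_prefs (R : realType) (V : finType) (s : {perm V})
    (theta : profile R V) : profile R V :=
  fun i => ((theta (s i)).1, (theta i).2).

Definition anonymous_on_distances (R : realType) (V : finType) (f : scf R V) :
    Prop :=
  forall (N rm : {set V}) (theta : profile R V), network N rm theta ->
  forall (d : nat) (S : {set V}), S \subset at_distance rm theta d ->
  forall s : {perm V}, perm_on S s ->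
    f (observed rm theta) = f (observed rm (permute_prefs s theta)).

(* The preferences in [theta] other than that of [i] are immaterial here: what
   the others may report depends only on their children in the network. *)
Definition voter_relevant (R : realType) (V : finType) (d : nat) (f : scf R V) :
    Prop :=
  forall (N rm : {set V}) (theta : profile R V), network N rm theta ->
  forall (i : V) (d' : nat), (1 <= d' <= d)%N ->
    i \in at_distance rm theta d' ->
  exists theta' : profile R V,
    (forall j, j \in N -> j != i -> reportable (theta j) (theta' j)) /\
    exists ti' ti'' : vtype R V,
      [/\ reportable (theta i) ti', reportable (theta i) ti''
        & f (observed rm (upd theta' i ti'))
          <> f (observed rm (upd theta' i ti''))].

(* Main.v *)
Require Import Defs.
From mathcomp Require Import all_boot all_order all_fingroup all_algebra.
From mathcomp Require Import boolp reals.

(* The outcome is the lowest peak among the children of the moderator.  They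
   are the participants whom no participant reports as a child, hence visible
   in the reports, and no voter's report can add or remove one of them.  So the
   children that a voter reports are irrelevant, and among preferences the
   minimum rule is strategy-proof.  Its value is the peak of a participant,
   which makes it Pareto efficient. *)

Set Implicit Arguments.
Unset Strict Implicit.
Unset Printing Implicit Defensive.

Import Order.TTheory GRing.Theory Num.Theory.
Local Open Scope ring_scope.

(** * Single-peaked preferences and their peaks *)

Section Preferences.
Variable R : realType.
Implicit Types (P : preference R) (x y p : outcome R).

Lemma outcome_eq x y : sval x = sval y -> x = y.
Proof. exact: val_inj. Qed.

Lemma weak_refl P x : P x x.
Proof. by case: (weak_complete P x x). Qed.

Lemma is_peak_strict P p x : is_peak P p -> x <> p -> strict P p x.
Proof.
move=> pk neq; apply: pk; case: (ltgtP (sval p) (sval x)) => [||/outcome_eq eqpx].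
- by left.
- by right.
- by case: neq.
Qed.

Lemma is_peak_weak P p x : is_peak P p -> P p x.
Proof.
move=> pk; case: (EM (x = p)) => [-> | neq]; first exact: weak_refl.
by case: (is_peak_strict pk neq).
Qed.

Lemma is_peak_unique P p q : is_peak P p -> is_peak P q -> p = q.
Proof.
move=> pkp pkq; case: (EM (p = q)) => // neq.
by case: (is_peak_strict pkq neq) => _ []; exact: is_peak_weak.
Qed.

(** Meant for strategy-proofness: under a minimum rule, a voter whose peak lies above the outcome
    can only push it further down. *)
Lemma is_peak_below P p x y :
  is_peak P p -> sval y <= sval x -> sval x <= sval p -> P x y.
Proof.
move=> pk; rewrite le_eqVlt => /orP[/eqP/outcome_eq -> _ | lt_yx le_xp].
  exact: weak_refl.
by have [] : strict P x y by apply: pk; right.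
Qed.

(** [cid] picks a witness of the existential; by [is_peak_unique] the choice is immaterial. *)
Definition peak P : outcome R := sval (cid (weak_single_peaked P)).

Lemma peakP P : is_peak P (peak P).
Proof. exact: svalP (cid (weak_single_peaked P)). Qed.

Definition outcome0 : outcome R.
Proof. by exists 0; rewrite lexx ler01. Defined.

Definition outcome1 : outcome R.
Proof. by exists 1; rewrite lexx ler01. Defined.

(** Together with [prefer_high], a witness for voter-relevance: the two peaks are the ends of the
    interval. *)
Definition prefer_low : preference R.
Proof.
exists (fun x y => sval x <= sval y).
- by move=> x y; apply/orP; exact: le_total.
- by move=> x y z; exact: le_trans.
- exists outcome0 => x y [[_ lt_xy] | [lt_yx]] /=.
    by split; [exact: ltW | apply/negP; rewrite -ltNge].
  by case/andP: (svalP y) => y0 _ /(lt_le_trans lt_yx); rewrite ltNge y0.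
Defined.

Definition prefer_high : preference R.
Proof.
exists (fun x y => sval y <= sval x).
- by move=> x y; apply/orP; exact: le_total.
- by move=> x y z le_yx le_zy; exact: le_trans le_zy le_yx.
- exists outcome1 => x y [[/= le_1x lt_xy] | [lt_yx _]].
    by case/andP: (svalP y) => _; rewrite leNgt (le_lt_trans le_1x lt_xy).
  by split; [exact: ltW | apply/negP; rewrite -ltNge].
Defined.

Lemma peak_prefer_low : sval (peak prefer_low) = 0.
Proof.
apply/eqP; rewrite eq_le; apply/andP; split;
  last by case/andP: (svalP (peak prefer_low)).
(* This preference is the order on outcomes itself, so liking the peak at least as much as
   [outcome0] says that the peak is at most 0. *)
exact: (is_peak_weak outcome0 (@peakP prefer_low)).
Qed.

Lemma peak_prefer_high : sval (peak prefer_high) = 1.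
Proof.
apply/eqP; rewrite eq_le; apply/andP; split;
  first by case/andP: (svalP (peak prefer_high)).
exact: (is_peak_weak outcome1 (@peakP prefer_high)).
Qed.

End Preferences.

(** * The rule, and its value on reports in a tree *)

Section LowestPeak.
Variables (R : realType) (V : finType).
Implicit Types (o : V -> option (vtype R V)) (A N rm : {set V}).
Implicit Types (theta : profile R V).

Definition roots o : {set V} :=
  [set i | isSome (o i) &
    ~~ [exists j, if o j is Some t then i \in t.2 else false]].

Definition pref_peak theta (i : V) : R := sval (peak (theta i).1).

Definition reported_peak o (i : V) : R :=
  if o i is Some t then sval (peak t.1) else 1.

Lemma bigmin_unit_interval A (F : V -> R) :
  (forall i, 0 <= F i <= 1) -> 0 <= \big[Order.min/1]_(i in A) F i <= 1.
Proof.
move=> F01; rewrite bigmin_le_id andbT; apply: le_bigmin => // i _.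
by case/andP: (F01 i).
Qed.

Lemma reported_peak_unit_interval o i : 0 <= reported_peak o i <= 1.
Proof.
rewrite /reported_peak; case: (o i) => [t|]; last by rewrite ler01 lexx.
exact: svalP (peak t.1).
Qed.

(** The unit 1 of the minimum on outcomes serves as the value when there are no roots, so the rule
    is total. *)
Definition lowest_root_peak : scf R V := fun o =>
  exist _ (\big[Order.min/1]_(i in roots o) reported_peak o i)
    (bigmin_unit_interval _ (reported_peak_unit_interval o)).

Definition subreport N theta theta' : Prop :=
  forall j, j \in N -> reportable (theta j) (theta' j).

Lemma subreport_refl N theta : subreport N theta theta.
Proof. by move=> j _; exact: subxx. Qed.

Lemma subreport_upd N theta theta' i t :
  (forall j, j \in N -> j != i -> reportable (theta j) (theta' j)) ->
  reportable (theta i) t -> subreport N theta (upd theta' i t).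
Proof.
move=> sub subi j jN; rewrite /upd; case: eqVneq => [-> // | neq].
exact: sub.
Qed.

(** Reports of voters in [N] only delete edges. Reports outside [N] are unconstrained, so the
    induction also carries that the walk stays in [N]. *)
Lemma subreport_path N rm theta theta' :
  network N rm theta -> subreport N theta theta' ->
  forall p, path (edge rm theta') None p -> path (edge rm theta) None p.
Proof.
move=> [rmN chN _] sub p.
pose inN x := if x is Some i then i \in N else true.
have edgeN x y : inN x -> edge rm theta' x y -> edge rm theta x y /\ inN y.
  case: x y => [i|] [j|] //= xN; last first.
    by move=> jrm; split=> //; exact: (subsetP rmN).
  move=> /(subsetP (sub i xN)) ji; split=> //.
  by have := subsetP (chN i xN) _ ji; rewrite !inE => /andP[].
have: inN None by [].
elim: p None => // y p IHp x xN /= /andP[/(edgeN _ _ xN)[-> yN] /=].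
exact: IHp.
Qed.

Lemma network_path_unique N rm theta i p q :
  network N rm theta -> i \in N ->
  path (edge rm theta) None p -> last None p = Some i ->
  path (edge rm theta) None q -> last None q = Some i -> p = q.
Proof.
move=> [_ _ tree] iN pathp lastp pathq lastq.
have [r [_ uniqr]] := tree i iN.
by rewrite -(uniqr p) ?(uniqr q).
Qed.

Lemma root_path rm theta i :
  i \in rm -> path (edge rm theta) None [:: Some i].
Proof. by move=> irm; rewrite /= irm. Qed.

Lemma root_participant rm theta i : i \in rm -> i \in participants rm theta.
Proof.
move=> irm; rewrite inE; apply/connectP.
by exists [:: Some i]; [exact: root_path | ].
Qed.

Lemma roots_observed N rm theta theta' :
  network N rm theta -> subreport N theta theta' ->
  roots (observed rm theta') = rm.
Proof.
move=> net sub; have [rmN _ _] := net; apply/setP=> i.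
rewrite inE /observed; apply/andP/idP=> [[] | irm].
  (* The last edge of a walk to [i] starts at the moderator or at a participant who reports [i]; the
     latter contradicts being a root. *)
  case: ifP => //; rewrite inE => /connectP[p]; case/lastP: p => // p y.
  rewrite last_rcons rcons_path => /andP[pathp ey] eqy _ /negP nochild.
  subst y; move: ey; case eqj: (last None p) => [j|] //= ij; case: nochild.
  apply/existsP; exists j; rewrite [j \in _](_ : _ = true) //.
  by rewrite inE; apply/connectP; exists p.
(* If a participant [j] reported [i], a walk through [j] would have to equal the single edge from
   the moderator to [i]. Comparing lengths, the walk to [j] would be empty and end at the
   moderator. *)
rewrite root_participant //; split=> //; apply/negP=> /existsP[j].
case: ifP => //; rewrite inE => /connectP[p pathp lastp] ij.
have: path (edge rm theta') None (rcons p (Some i)).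
  by rewrite rcons_path pathp -lastp.
move/(subreport_path net sub) => pathpi.
have := network_path_unique net (subsetP rmN _ irm) pathpi (last_rcons _ _ _)
  (root_path theta irm) erefl.
by move/(congr1 size); rewrite size_rcons => -[/size0nil p0]; rewrite p0 in lastp.
Qed.

(** From here on the reported graph drops out: the minimum runs over the fixed set [rm]. *)
Lemma lowest_root_peakE N rm theta theta' :
  network N rm theta -> subreport N theta theta' ->
  sval (lowest_root_peak (observed rm theta')) =
  \big[Order.min/1]_(i in rm) pref_peak theta' i.
Proof.
move=> net sub /=; rewrite (roots_observed net sub); apply: eq_bigr => i irm.
by rewrite /reported_peak /observed root_participant.
Qed.

Lemma pref_peak_le1 theta i : pref_peak theta i <= 1.
Proof. by case/andP: (svalP (peak (theta i).1)). Qed.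

Lemma at_distance1 rm theta i : (i \in at_distance rm theta 1) = (i \in rm).
Proof.
rewrite inE; apply/andP/idP => [[_ /existsP[p]] | irm].
  case/tupleP: p => x p; rewrite tuple0 /= andbT => /andP[ex /eqP eqx].
  by rewrite eqx in ex.
split; first exact: root_participant.
by apply/existsP; exists [tuple Some i]; rewrite root_path //=.
Qed.

(** The edge from the moderator is the only walk to [i]. With [at_distance1], each distance layer is
    thus either [rm] or disjoint from it. *)
Lemma at_distance_root N rm theta d i :
  network N rm theta -> i \in rm -> i \in at_distance rm theta d -> d = 1%N.
Proof.
move=> net irm; rewrite inE => /andP[_ /existsP[p /andP[pathp /eqP lastp]]].
have [rmN _ _] := net.
rewrite -(size_tuple p).
by rewrite (network_path_unique net (subsetP rmN _ irm) pathp lastp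
  (root_path theta irm) erefl).
Qed.

Lemma pref_peak_upd theta i t j :
  pref_peak (upd theta i t) j =
  if j == i then sval (peak t.1) else pref_peak theta j.
Proof. by rewrite /pref_peak /upd; case: ifP. Qed.

(** * The four properties *)

Lemma lowest_root_peak_strategy_proof : strategy_proof lowest_root_peak.
Proof.
move=> N rm theta net i iN theta' sub ti' subi.
set P := (theta i).1.
set f1 := lowest_root_peak _; set f2 := lowest_root_peak _.
have f1E := lowest_root_peakE net (subreport_upd sub (subxx (theta i).2)).
have f2E := lowest_root_peakE net (subreport_upd sub subi).
rewrite -/f1 in f1E; rewrite -/f2 in f2E.
have upd_other t j : j != i -> pref_peak (upd theta' i t) j = pref_peak theta' j.
  by move=> /negPf neq; rewrite pref_peak_upd neq.
case: (boolP (i \in rm)) => irm; last first.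
  suff -> : f1 = f2 by exact: weak_refl.
  apply: outcome_eq; rewrite f1E f2E.
  apply: eq_bigr => j jrm.
  by rewrite !upd_other //; apply: contraNneq irm => <-.
(* Compare with the lowest peak [c] reported by the other roots: truth yields the minimum of the own
   peak and [c], and any report yields at most [c]. So truth yields either the own peak, or [c]
   below it, where a lie can only lower the outcome. *)
have {}f1E : sval f1 = Order.min (sval (peak P))
    (\big[Order.min/1]_(j in rm | j != i) pref_peak theta' j).
  rewrite f1E (bigminD1 i) // pref_peak_upd eqxx; congr Order.min.
  by apply: eq_bigr => j /andP[_ /upd_other].
have {}f2E : sval f2 <= \big[Order.min/1]_(j in rm | j != i) pref_peak theta' j.
  rewrite f2E (bigminD1 i) // ge_min; apply/orP; right.
  by rewrite le_eqVlt; apply/orP; left; apply/eqP/eq_bigr => j /andP[_ /upd_other].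
move: f1E f2E; set c := \big[_/_]_(_ in _ | _) _ => f1E f2E.
case: (leP (sval (peak P)) c) => [le_pc | /ltW le_cp].
  have -> : f1 = peak P by apply: outcome_eq; rewrite f1E min_l.
  exact: is_peak_weak (@peakP _ P).
have {}f1E : sval f1 = c by rewrite f1E min_r.
by apply: is_peak_below (@peakP _ P) _ _; rewrite f1E.
Qed.

Lemma lowest_root_peak_pareto : pareto_efficient lowest_root_peak.
Proof.
move=> N rm theta net [o [weak_o [i ipart strict_o]]].
(* A nonempty [rm] ensures that the minimum is attained at some child of the moderator, and is not
   merely the default 1. *)
have [r rrm] : exists r, r \in rm.
  move: ipart; rewrite inE => /connectP[[|[r|] p]] //= /andP[rrm _] _.
  by exists r.
have fE := lowest_root_peakE net (@subreport_refl N theta).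
have [k krm kE] := eq_bigmin r (mem rm) (pref_peak theta) rrm
  (fun i _ => pref_peak_le1 theta i).
rewrite kE in fE.
have {}fE : lowest_root_peak (observed rm theta) = peak (theta k).1.
  exact: outcome_eq.
rewrite fE in weak_o strict_o.
have := weak_o k (root_participant _ krm).
case: (EM (o = peak (theta k).1)) => [eqo | neq].
  by move: strict_o; rewrite eqo => -[].
by have [_ not_weak] := is_peak_strict (@peakP _ (theta k).1) neq; move/not_weak.
Qed.

Lemma lowest_root_peak_anonymous : anonymous_on_distances lowest_root_peak.
Proof.
move=> N rm theta net d S subS s onS.
have sub : subreport N theta (permute_prefs s theta).
  by move=> j _; exact: subxx.
apply: outcome_eq.
rewrite (lowest_root_peakE net (@subreport_refl N theta)).
rewrite (lowest_root_peakE net sub).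
(* Reindexing by [s] matches the two minima once [rm] is stable under [s], which holds because [s]
   moves voters only within one layer. *)
rewrite (reindex_inj (@perm_inj _ s)) /=.
apply: eq_bigl => i.
have stable (j : V) : j \in S -> (j \in rm) = (d == 1%N).
  move=> /(subsetP subS) jd; apply/idP/eqP => [jrm | d1].
    exact: at_distance_root net jrm jd.
  by move: jd; rewrite d1 at_distance1.
case: (boolP (i \in S)) => iS; last by rewrite (out_perm onS iS).
by rewrite !stable ?(perm_closed _ onS).
Qed.

Lemma lowest_root_peak_relevant : voter_relevant 1 lowest_root_peak.
Proof.
move=> N rm theta net i d'; rewrite -eqn_leq => /eqP <-.
rewrite at_distance1 => irm.
(* When all others report peak 1, the outcome is the peak that [i] reports. The empty set of
   children is an admissible report for everyone. *)
pose high : vtype R V := (prefer_high R, set0).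
pose low : vtype R V := (prefer_low R, set0).
have sub j : j \in N -> j != i -> reportable (theta j) high.
  by move=> _ _; exact: sub0set.
exists (fun=> high); split=> //; exists high, low.
split; [exact: sub0set | exact: sub0set | move/(congr1 sval)].
have subi P : reportable (theta i) (P, set0) by exact: sub0set.
rewrite !(lowest_root_peakE net (subreport_upd sub (subi _))).
have -> : \big[Order.min/1]_(j in rm) pref_peak (upd (fun=> high) i high) j = 1.
  apply: big1_idem => [|j _]; first exact: minxx.
  by rewrite pref_peak_upd /pref_peak peak_prefer_high if_same.
rewrite (bigminD1 i) // pref_peak_upd eqxx peak_prefer_low => eq1.
have : Order.min 0 (\big[Order.min/1]_(j in rm | j != i)
    pref_peak (upd (fun=> high) i low) j) <= 0 by rewrite ge_min lexx.
by rewrite -eq1 ler10.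
Qed.
End LowestPeak.

Theorem theorem4 (R : realType) (V : finType) :
  exists f : scf R V,
    [/\ strategy_proof f,
        pareto_efficient f,
        anonymous_on_distances f
      & voter_relevant 1 f].
Proof.
exists (@lowest_root_peak R V); split.
- exact: lowest_root_peak_strategy_proof.
- exact: lowest_root_peak_pareto.
- exact: lowest_root_peak_anonymous.
- exact: lowest_root_peak_relevant.
Qed.
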